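(* There exists a unique element $\mathrm{BCH}(x,y)\in\widehat{s\mathrm{Lie}}(x,y)$ satisfying $$e^{\mathrm{ad}_{\mathrm{BCH}(x,y)}}=e^{\mathrm{ad}_x}\,e^{\mathrm{ad}_y}$$ (as operators on $\widehat{s\mathrm{Lie}}(x,y)$).
   Context: $\mathbb K$ is a field of characteristic $0$. A shifted Lie algebra ($s\mathrm{Lie}$-algebra) is a graded vector space with a graded symmetric bracket $[-,-]$ of degree $-1$ such that the desuspension is a graded Lie algebra. $\widehat{s\mathrm{Lie}}(x,y)$ is the free complete shifted Lie algebra on two generators $x,y$ of degree $1$ (with zero differential): since it is concentrated in degree $1$, it is the completion, with respect to the filtration by bracket length, of the ordinary free Lie algebra over $\mathbb K$ on $x$ and $y$ (infinite sums of brackets of increasing length are allowed). $\mathrm{ad}_a=[a,-]$ and $e^{\mathrm{ad}_a}=\sum_{k\ge0}\frac1{k!}\mathrm{ad}_a^k$. *)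

(* Defs.v *)
From HB Require Import structures.
From mathcomp Require Import all_boot all_algebra.
From mathcomp Require Import boolp classical_sets.

Set Implicit Arguments.
Unset Strict Implicit.
Unset Printing Implicit Defensive.

Import GRing.Theory.
Local Open Scope ring_scope.
Local Open Scope quotient_scope.

HB.mixin Record Lmodule_isLie (K : fieldType) L of GRing.Lmodule K L := {
  lie : L -> L -> L;
  lieDl : forall a b c, lie (a + b) c = lie a c + lie b c;
  lieDr : forall a b c, lie a (b + c) = lie a b + lie a c;
  lieZl : forall k a b, lie (k *: a) b = k *: lie a b;
  lieZr : forall k a b, lie a (k *: b) = k *: lie a b;
  liexx : forall a, lie a a = 0;
  lie_jacobi : forall a b c,
    lie a (lie b c) + lie b (lie c a) + lie c (lie a b) = 0
}.

#[short(type="lieAlgType")]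
HB.structure Definition LieAlgebra (K : fieldType) :=
  {L of Lmodule_isLie K L & GRing.Lmodule K L}.

Definition is_lie_morphism (K : fieldType) (L M : lieAlgType K) (f : L -> M) :=
  [/\ forall a b, f (a + b) = f a + f b,
      forall k a, f (k *: a) = k *: f a
    & forall a b, f (lie a b) = lie (f a) (f b)].

(* The free Lie algebra on a type X, presented as the algebra of Lie terms
   modulo the congruence generated by the axioms of Lie algebras. *)
Section FreeLieAlgebra.
Variables (K : fieldType) (X : Type).

Inductive lterm : Type :=
| LGen of X
| LZero
| LAdd of lterm & lterm
| LScale of K & lterm
| LLie of lterm & lterm.

Inductive lterm_eq : lterm -> lterm -> Prop :=
| LErefl s : lterm_eq s s
| LEsym s t : lterm_eq s t -> lterm_eq t s
| LEtrans s t u : lterm_eq s t -> lterm_eq t u -> lterm_eq s u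
| LEadd s s' t t' :
    lterm_eq s s' -> lterm_eq t t' -> lterm_eq (LAdd s t) (LAdd s' t')
| LEscale k s s' : lterm_eq s s' -> lterm_eq (LScale k s) (LScale k s')
| LElie s s' t t' :
    lterm_eq s s' -> lterm_eq t t' -> lterm_eq (LLie s t) (LLie s' t')
| LEaddA s t u : lterm_eq (LAdd s (LAdd t u)) (LAdd (LAdd s t) u)
| LEaddC s t : lterm_eq (LAdd s t) (LAdd t s)
| LEadd0 s : lterm_eq (LAdd LZero s) s
| LEaddN s : lterm_eq (LAdd (LScale (-1) s) s) LZero
| LEscaleA k l s : lterm_eq (LScale k (LScale l s)) (LScale (k * l) s)
| LEscale1 s : lterm_eq (LScale 1 s) s
| LEscaleDr k s t :
    lterm_eq (LScale k (LAdd s t)) (LAdd (LScale k s) (LScale k t))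
| LEscaleDl k l s :
    lterm_eq (LScale (k + l) s) (LAdd (LScale k s) (LScale l s))
| LElieDl s t u : lterm_eq (LLie (LAdd s t) u) (LAdd (LLie s u) (LLie t u))
| LElieDr s t u : lterm_eq (LLie s (LAdd t u)) (LAdd (LLie s t) (LLie s u))
| LElieZl k s t : lterm_eq (LLie (LScale k s) t) (LScale k (LLie s t))
| LElieZr k s t : lterm_eq (LLie s (LScale k t)) (LScale k (LLie s t))
| LEliexx s : lterm_eq (LLie s s) LZero
| LEjacobi s t u :
    lterm_eq (LAdd (LAdd (LLie s (LLie t u)) (LLie t (LLie u s)))
                   (LLie u (LLie s t))) LZero.

HB.instance Definition _ := gen_eqMixin lterm.
HB.instance Definition _ := gen_choiceMixin lterm.

Definition lterm_eqb : rel lterm := fun s t => `[< lterm_eq s t >].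

Lemma lterm_eqb_refl : reflexive lterm_eqb.
Proof. by move=> s; apply/asboolP; exact: LErefl. Qed.

Lemma lterm_eqb_sym : symmetric lterm_eqb.
Proof. by move=> s t; apply/asboolP/asboolP; exact: LEsym. Qed.

Lemma lterm_eqb_trans : transitive lterm_eqb.
Proof. by move=> t s u /asboolP st /asboolP tu; apply/asboolP/(LEtrans st). Qed.

Canonical lterm_equiv :=
  EquivRel lterm_eqb lterm_eqb_refl lterm_eqb_sym lterm_eqb_trans.

Definition free_lie := {eq_quot lterm_equiv}.
HB.instance Definition _ := Choice.on free_lie.
HB.instance Definition _ := EqQuotient.on free_lie.

Definition pi_free (s : lterm) : free_lie := \pi_free_lie s.

Lemma pi_freeP s t : pi_free s = pi_free t <-> lterm_eq s t.
Proof.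
split=> [st|st]; last by apply/eqP; rewrite /pi_free piE; apply/asboolP.
by move: st => /eqP; rewrite /pi_free piE => /asboolP.
Qed.

Lemma repr_freeK (a : free_lie) : pi_free (repr a) = a.
Proof. exact: reprK. Qed.

Lemma pi_free_repr s : lterm_eq (repr (pi_free s)) s.
Proof. by apply/pi_freeP; rewrite repr_freeK. Qed.

Definition fgen (x : X) : free_lie := pi_free (LGen x).
Definition fzero : free_lie := pi_free LZero.
Definition fadd (a b : free_lie) : free_lie := pi_free (LAdd (repr a) (repr b)).
Definition fscale (k : K) (a : free_lie) : free_lie :=
  pi_free (LScale k (repr a)).
Definition flie (a b : free_lie) : free_lie := pi_free (LLie (repr a) (repr b)).

Lemma pi_freeD s t : pi_free (LAdd s t) = fadd (pi_free s) (pi_free t).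
Proof. by apply/pi_freeP/LEsym/LEadd; apply: pi_free_repr. Qed.

Lemma pi_freeZ k s : pi_free (LScale k s) = fscale k (pi_free s).
Proof. by apply/pi_freeP/LEsym/LEscale; apply: pi_free_repr. Qed.

Lemma pi_free_lie s t : pi_free (LLie s t) = flie (pi_free s) (pi_free t).
Proof. by apply/pi_freeP/LEsym/LElie; apply: pi_free_repr. Qed.

Let fE := (pi_freeD, pi_freeZ, pi_free_lie).

Fact faddA : associative fadd.
Proof.
move=> a b c; rewrite -(repr_freeK a) -(repr_freeK b) -(repr_freeK c) -!fE.
exact/pi_freeP/LEaddA.
Qed.

Fact faddC : commutative fadd.
Proof.
move=> a b; rewrite -(repr_freeK a) -(repr_freeK b) -!fE.
exact/pi_freeP/LEaddC.
Qed.

Fact fadd0 : left_id fzero fadd.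
Proof. by move=> a; rewrite -(repr_freeK a) -!fE; apply/pi_freeP/LEadd0. Qed.

Fact faddN : left_inverse fzero (fscale (-1)) fadd.
Proof. by move=> a; rewrite -(repr_freeK a) -!fE; apply/pi_freeP/LEaddN. Qed.

HB.instance Definition _ :=
  GRing.isZmodule.Build free_lie faddA faddC fadd0 faddN.

Fact fscaleA k l a : fscale k (fscale l a) = fscale (k * l) a.
Proof. by rewrite -(repr_freeK a) -!fE; apply/pi_freeP/LEscaleA. Qed.

Fact fscale1 : left_id 1 fscale.
Proof. by move=> a; rewrite -(repr_freeK a) -!fE; apply/pi_freeP/LEscale1. Qed.

Fact fscaleDr : right_distributive fscale +%R.
Proof.
move=> k a b; rewrite -(repr_freeK a) -(repr_freeK b).
by rewrite -[RHS]/(fadd _ _) -[_ + _]/(fadd _ _) -!fE; apply/pi_freeP/LEscaleDr.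
Qed.

Fact fscaleDl a : {morph fscale^~ a : k l / k + l}.
Proof.
move=> k l; rewrite -(repr_freeK a) -[RHS]/(fadd _ _) -!fE.
exact/pi_freeP/LEscaleDl.
Qed.

HB.instance Definition _ := GRing.Zmodule_isLmodule.Build K free_lie
  fscaleA fscale1 fscaleDr fscaleDl.

Fact flieDl a b c : flie (a + b) c = flie a c + flie b c.
Proof.
rewrite -(repr_freeK a) -(repr_freeK b) -(repr_freeK c).
rewrite -[RHS]/(fadd _ _) -[_ + _]/(fadd _ _) -!fE.
exact/pi_freeP/LElieDl.
Qed.

Fact flieDr a b c : flie a (b + c) = flie a b + flie a c.
Proof.
rewrite -(repr_freeK a) -(repr_freeK b) -(repr_freeK c).
rewrite -[RHS]/(fadd _ _) -[_ + _]/(fadd _ _) -!fE.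
exact/pi_freeP/LElieDr.
Qed.

Fact flieZl k a b : flie (k *: a) b = k *: flie a b.
Proof.
rewrite -(repr_freeK a) -(repr_freeK b).
rewrite -[RHS]/(fscale _ _) -[_ *: _]/(fscale _ _) -!fE.
exact/pi_freeP/LElieZl.
Qed.

Fact flieZr k a b : flie a (k *: b) = k *: flie a b.
Proof.
rewrite -(repr_freeK a) -(repr_freeK b).
rewrite -[RHS]/(fscale _ _) -[_ *: _]/(fscale _ _) -!fE.
exact/pi_freeP/LElieZr.
Qed.

Fact fliexx a : flie a a = 0.
Proof. by rewrite -(repr_freeK a) -!fE; apply/pi_freeP/LEliexx. Qed.

Fact flie_jacobi a b c :
  flie a (flie b c) + flie b (flie c a) + flie c (flie a b) = 0.
Proof.
rewrite -(repr_freeK a) -(repr_freeK b) -(repr_freeK c).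
rewrite -[LHS]/(fadd (fadd _ _) _) -!fE.
exact/pi_freeP/LEjacobi.
Qed.

HB.instance Definition _ := Lmodule_isLie.Build K free_lie
  flieDl flieDr flieZl flieZr fliexx flie_jacobi.

Lemma free_lie_ind (P : free_lie -> Prop) :
  (forall x, P (fgen x)) -> P 0 ->
  (forall a b, P a -> P b -> P (a + b)) ->
  (forall k a, P a -> P (k *: a)) ->
  (forall a b, P a -> P b -> P (lie a b)) ->
  forall a, P a.
Proof.
move=> Pg P0 PD PZ PL a; rewrite -(repr_freeK a).
elim: (repr a) => //= [s Ps t Pt|k s Ps|s Ps t Pt].
- by rewrite pi_freeD; apply: PD.
- by rewrite pi_freeZ; apply: PZ.
- by rewrite pi_free_lie; apply: PL.
Qed.

Fixpoint lterm_eval (M : lieAlgType K) (g : X -> M) (s : lterm) : M :=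
  match s with
  | LGen x => g x
  | LZero => 0
  | LAdd s t => lterm_eval g s + lterm_eval g t
  | LScale k s => k *: lterm_eval g s
  | LLie s t => lie (lterm_eval g s) (lterm_eval g t)
  end.

Lemma lterm_eval_eq (M : lieAlgType K) (g : X -> M) s t :
  lterm_eq s t -> lterm_eval g s = lterm_eval g t.
Proof.
elim=> {s t} //=.
- by move=> s t u _ -> _ ->.
- by move=> s s' t t' _ -> _ ->.
- by move=> k s s' _ ->.
- by move=> s s' t t' _ -> _ ->.
- by move=> *; rewrite addrA.
- by move=> *; rewrite addrC.
- by move=> *; rewrite add0r.
- by move=> s; rewrite scaleN1r addNr.
- by move=> *; rewrite scalerA.
- by move=> *; rewrite scale1r.
- by move=> *; rewrite scalerDr.
- by move=> *; rewrite scalerDl.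
- by move=> *; rewrite lieDl.
- by move=> *; rewrite lieDr.
- by move=> *; rewrite lieZl.
- by move=> *; rewrite lieZr.
- by move=> *; rewrite liexx.
- by move=> *; rewrite lie_jacobi.
Qed.

Theorem free_lie_universal (M : lieAlgType K) (g : X -> M) :
  exists! f : free_lie -> M,
    is_lie_morphism f /\ forall x, f (fgen x) = g x.
Proof.
have evalE s : lterm_eval g (repr (pi_free s)) = lterm_eval g s.
  exact/lterm_eval_eq/pi_free_repr.
exists (fun a => lterm_eval g (repr a)); split.
  split=> [|x]; last by rewrite evalE.
  split=> [a b|k a|a b].
  - by rewrite -[a + b]/(fadd a b) evalE.
  - by rewrite -[k *: a]/(fscale k a) evalE.
  - by rewrite -[lie a b]/(flie a b) evalE.
move=> f [[fD fZ fL] fg]; apply/funext.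
have f0 : f 0 = 0 by rewrite -(scale0r 0) fZ scale0r.
have ev s : f (pi_free s) = lterm_eval g s.
  elim: s => [x||s Ps t Pt|k s Ps|s Ps t Pt] /=.
  - exact: fg.
  - exact: f0.
  - by rewrite pi_freeD fD Ps Pt.
  - by rewrite pi_freeZ fZ Ps.
  - by rewrite pi_free_lie fL Ps Pt.
by move=> a; rewrite -[in RHS](repr_freeK a) ev.
Qed.

Inductive is_bracket : nat -> free_lie -> Prop :=
| bracket_gen x : is_bracket 1 (fgen x)
| bracket_lie p q a b :
    is_bracket p a -> is_bracket q b -> is_bracket (p + q) (lie a b).

(* filt n is the linear span of the iterated brackets of length at least n. *)
Inductive filt (n : nat) : free_lie -> Prop :=
| filt_bracket m a : (n <= m)%N -> is_bracket m a -> filt n a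
| filt0 : filt n 0
| filtD a b : filt n a -> filt n b -> filt n (a + b)
| filtZ k a : filt n a -> filt n (k *: a).

Lemma filtB n a b : filt n a -> filt n b -> filt n (a - b).
Proof. by move=> Fa Fb; rewrite -scaleN1r; apply/filtD/filtZ. Qed.

Lemma filt_le n m a : (n <= m)%N -> filt m a -> filt n a.
Proof.
move=> nm; elim=> {a} [p a mp|||k a _]; last exact: filtZ.
- by apply: filt_bracket; apply: leq_trans mp.
- exact: filt0.
- by move=> a b _ Fa _ Fb; apply: filtD.
Qed.

Lemma lie0 (L : lieAlgType K) (a : L) : lie 0 a = 0.
Proof. by rewrite -(scale0r (0 : L)) lieZl !scale0r. Qed.

Lemma lier0 (L : lieAlgType K) (a : L) : lie a 0 = 0.
Proof. by rewrite -(scale0r (0 : L)) lieZr !scale0r. Qed.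

Lemma filt_lie n m a b : filt n a -> filt m b -> filt (n + m) (lie a b).
Proof.
elim=> {a} [p a np Ba||a a' _ Fa _ Fa'|k a _ Fa] Fb.
- elim: Fb => {b} [q b mq Bb||b b' _ Fb _ Fb'|k b _ Fb].
  + by apply: (@filt_bracket _ (p + q)); [apply: leq_add|apply: bracket_lie].
  + by rewrite lier0; apply: filt0.
  + by rewrite lieDr; apply: filtD.
  + by rewrite lieZr; apply: filtZ.
- by rewrite lie0; apply: filt0.
- by rewrite lieDl; apply: filtD; auto.
- by rewrite lieZl; apply: filtZ; auto.
Qed.

Lemma filt1 a : filt 1 a.
Proof.
elim/free_lie_ind: a => [x||a b|k a|a b Fa Fb].
- by apply: (filt_bracket (leqnn 1)); apply: bracket_gen.
- exact: filt0.
- exact: filtD.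
- exact: filtZ.
- by apply: (@filt_le 1 2) => //; apply: (@filt_lie 1 1).
Qed.

Lemma filt_liel n a b : filt n a -> filt n (lie a b).
Proof.
by move=> Fa; apply: (@filt_le n (n + 1)); rewrite ?leq_addr//; apply/filt_lie/filt1.
Qed.

Lemma filt_lier n a b : filt n b -> filt n (lie a b).
Proof.
by move=> Fb; apply: (@filt_le n (1 + n)); rewrite ?leq_addl//; apply/filt_lie/Fb/filt1.
Qed.

Section Truncation.
Variable n : nat.

Definition filt_eqb : rel free_lie := fun a b => `[< filt n (a - b) >].

Lemma filt_eqb_refl : reflexive filt_eqb.
Proof. by move=> a; apply/asboolP; rewrite subrr; apply: filt0. Qed.

Lemma filt_eqb_sym : symmetric filt_eqb.
Proof.
have H a b : filt n (a - b) -> filt n (b - a).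
  by move=> Fab; rewrite -opprB -scaleN1r; apply: filtZ.
by move=> a b; apply/asboolP/asboolP; apply: H.
Qed.

Lemma filt_eqb_trans : transitive filt_eqb.
Proof.
move=> b a c /asboolP ab /asboolP bc; apply/asboolP.
by rewrite -(subrKA b); apply: filtD.
Qed.

Canonical filt_equiv :=
  EquivRel filt_eqb filt_eqb_refl filt_eqb_sym filt_eqb_trans.

Definition trunc_lie := {eq_quot filt_equiv}.
HB.instance Definition _ := Choice.on trunc_lie.
HB.instance Definition _ := EqQuotient.on trunc_lie.

Definition pi_trunc (a : free_lie) : trunc_lie := \pi_trunc_lie a.

Lemma pi_truncP a b : pi_trunc a = pi_trunc b <-> filt n (a - b).
Proof.
split=> [ab|ab]; last by apply/eqP; rewrite /pi_trunc piE; apply/asboolP.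
by move: ab => /eqP; rewrite /pi_trunc piE => /asboolP.
Qed.

Lemma repr_truncK (u : trunc_lie) : pi_trunc (repr u) = u.
Proof. exact: reprK. Qed.

Lemma pi_trunc_repr a : filt n (repr (pi_trunc a) - a).
Proof. by apply/pi_truncP; rewrite repr_truncK. Qed.

Definition tzero : trunc_lie := pi_trunc 0.
Definition topp (u : trunc_lie) : trunc_lie := pi_trunc (- repr u).
Definition tadd (u v : trunc_lie) : trunc_lie := pi_trunc (repr u + repr v).
Definition tscale (k : K) (u : trunc_lie) : trunc_lie := pi_trunc (k *: repr u).
Definition tlie (u v : trunc_lie) : trunc_lie := pi_trunc (lie (repr u) (repr v)).

Lemma pi_truncN a : pi_trunc (- a) = topp (pi_trunc a).
Proof.
apply/esym/pi_truncP; rewrite -opprD -scaleN1r; apply/filtZ/pi_trunc_repr.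
Qed.

Lemma pi_truncD a b : pi_trunc (a + b) = tadd (pi_trunc a) (pi_trunc b).
Proof.
apply/esym/pi_truncP; rewrite opprD addrACA.
by apply: filtD; apply: pi_trunc_repr.
Qed.

Lemma pi_truncZ k a : pi_trunc (k *: a) = tscale k (pi_trunc a).
Proof.
apply/esym/pi_truncP; rewrite -scalerBr; apply/filtZ/pi_trunc_repr.
Qed.

Lemma pi_trunc_lie a b : pi_trunc (lie a b) = tlie (pi_trunc a) (pi_trunc b).
Proof.
apply/esym/pi_truncP; set a' := repr _; set b' := repr _.
have -> : lie a' b' - lie a b = lie (a' - a) b' + lie a (b' - b).
  by rewrite lieDl lieDr -!scaleN1r lieZl lieZr !scaleN1r addrA subrK.
by apply: filtD; [apply/filt_liel/pi_trunc_repr|apply/filt_lier/pi_trunc_repr].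
Qed.

Let tE := (pi_truncN, pi_truncD, pi_truncZ, pi_trunc_lie).

Fact taddA : associative tadd.
Proof.
move=> u v w; rewrite -(repr_truncK u) -(repr_truncK v) -(repr_truncK w).
by rewrite -!tE addrA.
Qed.

Fact taddC : commutative tadd.
Proof. by move=> u v; rewrite /tadd addrC. Qed.

Fact tadd0 : left_id tzero tadd.
Proof. by move=> u; rewrite -(repr_truncK u) -!tE add0r. Qed.

Fact taddN : left_inverse tzero topp tadd.
Proof. by move=> u; rewrite -(repr_truncK u) -!tE addNr. Qed.

HB.instance Definition _ :=
  GRing.isZmodule.Build trunc_lie taddA taddC tadd0 taddN.

Fact tscaleA k l u : tscale k (tscale l u) = tscale (k * l) u.
Proof. by rewrite -(repr_truncK u) -!tE scalerA. Qed.

Fact tscale1 : left_id 1 tscale.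
Proof. by move=> u; rewrite -(repr_truncK u) -!tE scale1r. Qed.

Fact tscaleDr : right_distributive tscale +%R.
Proof.
move=> k u v; rewrite -(repr_truncK u) -(repr_truncK v).
by rewrite -[RHS]/(tadd _ _) -[_ + _]/(tadd _ _) -!tE scalerDr.
Qed.

Fact tscaleDl u : {morph tscale^~ u : k l / k + l}.
Proof.
by move=> k l; rewrite -(repr_truncK u) -[RHS]/(tadd _ _) -!tE scalerDl.
Qed.

HB.instance Definition _ := GRing.Zmodule_isLmodule.Build K trunc_lie
  tscaleA tscale1 tscaleDr tscaleDl.

Fact tlieDl u v w : tlie (u + v) w = tlie u w + tlie v w.
Proof.
rewrite -(repr_truncK u) -(repr_truncK v) -(repr_truncK w).
by rewrite -[RHS]/(tadd _ _) -[_ + _]/(tadd _ _) -!tE lieDl.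
Qed.

Fact tlieDr u v w : tlie u (v + w) = tlie u v + tlie u w.
Proof.
rewrite -(repr_truncK u) -(repr_truncK v) -(repr_truncK w).
by rewrite -[RHS]/(tadd _ _) -[_ + _]/(tadd _ _) -!tE lieDr.
Qed.

Fact tlieZl k u v : tlie (k *: u) v = k *: tlie u v.
Proof.
rewrite -(repr_truncK u) -(repr_truncK v).
by rewrite -[RHS]/(tscale _ _) -[_ *: _]/(tscale _ _) -!tE lieZl.
Qed.

Fact tlieZr k u v : tlie u (k *: v) = k *: tlie u v.
Proof.
rewrite -(repr_truncK u) -(repr_truncK v).
by rewrite -[RHS]/(tscale _ _) -[_ *: _]/(tscale _ _) -!tE lieZr.
Qed.

Fact tliexx u : tlie u u = 0.
Proof. by rewrite -(repr_truncK u) -!tE liexx. Qed.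

Fact tlie_jacobi u v w :
  tlie u (tlie v w) + tlie v (tlie w u) + tlie w (tlie u v) = 0.
Proof.
rewrite -(repr_truncK u) -(repr_truncK v) -(repr_truncK w).
by rewrite -[LHS]/(tadd (tadd _ _) _) -!tE lie_jacobi.
Qed.

HB.instance Definition _ := Lmodule_isLie.Build K trunc_lie
  tlieDl tlieDr tlieZl tlieZr tliexx tlie_jacobi.

Lemma pi_trunc_morphism : is_lie_morphism pi_trunc.
Proof.
split=> [a b|k a|a b]; first exact: pi_truncD.
- exact: pi_truncZ.
- exact: pi_trunc_lie.
Qed.

End Truncation.

Definition trans (n : nat) (u : trunc_lie n.+1) : trunc_lie n :=
  pi_trunc n (repr u).

Lemma trans_pi n a : trans (pi_trunc n.+1 a) = pi_trunc n a.
Proof. by apply/pi_truncP; apply/filt_le/pi_trunc_repr. Qed.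

Lemma trans_morphism n : is_lie_morphism (@trans n).
Proof.
have [pD pZ pL] := pi_trunc_morphism n.
have [qD qZ qL] := pi_trunc_morphism n.+1.
split=> [u v|k u|u v].
- rewrite -(repr_truncK u) -(repr_truncK v) -qD !trans_pi; exact: pD.
- rewrite -(repr_truncK u) -qZ !trans_pi; exact: pZ.
- rewrite -(repr_truncK u) -(repr_truncK v) -qL !trans_pi; exact: pL.
Qed.

(* The completion of free_lie with respect to filt, i.e. the inverse limit of
   the quotients free_lie / filt n. *)
Record cfree_lie := CFreeLie {
  cproj :> forall n, trunc_lie n;
  cprojP : forall n, trans (cproj n.+1) = cproj n
}.

HB.instance Definition _ := gen_eqMixin cfree_lie.
HB.instance Definition _ := gen_choiceMixin cfree_lie.

Lemma cfree_lieP (a b : cfree_lie) : (forall n, a n = b n) -> a = b.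
Proof.
case: a b => [a Pa] [b Pb] /= ab.
have {}ab : a = b by apply: functional_extensionality_dep.
by case: b / ab in Pb *; rewrite (Prop_irrelevance Pa Pb).
Qed.

Fact chatP a n : trans (pi_trunc n.+1 a) = pi_trunc n a.
Proof. exact: trans_pi. Qed.
Definition chat (a : free_lie) : cfree_lie :=
  @CFreeLie (fun n => pi_trunc n a) (chatP a).

Fact czeroP n : trans (0 : trunc_lie n.+1) = 0.
Proof. exact: trans_pi. Qed.
Definition czero := CFreeLie czeroP.

Fact caddP (a b : cfree_lie) n : trans (a n.+1 + b n.+1) = a n + b n.
Proof. by have [-> _ _] := trans_morphism n; rewrite !cprojP. Qed.
Definition cadd a b := CFreeLie (caddP a b).

Fact cscaleP k (a : cfree_lie) n : trans (k *: a n.+1) = k *: a n.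
Proof. by have [_ -> _] := trans_morphism n; rewrite !cprojP. Qed.
Definition cscale k a := CFreeLie (cscaleP k a).

Fact clieP (a b : cfree_lie) n : trans (lie (a n.+1) (b n.+1)) = lie (a n) (b n).
Proof. by have [_ _ ->] := trans_morphism n; rewrite !cprojP. Qed.
Definition clie a b := CFreeLie (clieP a b).

Fact caddA : associative cadd.
Proof. by move=> a b c; apply: cfree_lieP => n /=; rewrite addrA. Qed.

Fact caddC : commutative cadd.
Proof. by move=> a b; apply: cfree_lieP => n /=; rewrite addrC. Qed.

Fact cadd0 : left_id czero cadd.
Proof. by move=> a; apply: cfree_lieP => n /=; rewrite add0r. Qed.

Fact caddN : left_inverse czero (cscale (-1)) cadd.
Proof. by move=> a; apply: cfree_lieP => n /=; rewrite scaleN1r addNr. Qed.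

HB.instance Definition _ :=
  GRing.isZmodule.Build cfree_lie caddA caddC cadd0 caddN.

Fact cscaleA k l a : cscale k (cscale l a) = cscale (k * l) a.
Proof. by apply: cfree_lieP => n /=; rewrite scalerA. Qed.

Fact cscale1 : left_id 1 cscale.
Proof. by move=> a; apply: cfree_lieP => n /=; rewrite scale1r. Qed.

Fact cscaleDr : right_distributive cscale +%R.
Proof. by move=> k a b; apply: cfree_lieP => n /=; rewrite scalerDr. Qed.

Fact cscaleDl a : {morph cscale^~ a : k l / k + l}.
Proof. by move=> k l; apply: cfree_lieP => n /=; rewrite scalerDl. Qed.

HB.instance Definition _ := GRing.Zmodule_isLmodule.Build K cfree_lie
  cscaleA cscale1 cscaleDr cscaleDl.

Fact clieDl a b c : clie (a + b) c = clie a c + clie b c.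
Proof. by apply: cfree_lieP => n /=; rewrite lieDl. Qed.

Fact clieDr a b c : clie a (b + c) = clie a b + clie a c.
Proof. by apply: cfree_lieP => n /=; rewrite lieDr. Qed.

Fact clieZl k a b : clie (k *: a) b = k *: clie a b.
Proof. by apply: cfree_lieP => n /=; rewrite lieZl. Qed.

Fact clieZr k a b : clie a (k *: b) = k *: clie a b.
Proof. by apply: cfree_lieP => n /=; rewrite lieZr. Qed.

Fact cliexx a : clie a a = 0.
Proof. by apply: cfree_lieP => n /=; rewrite liexx. Qed.

Fact clie_jacobi a b c :
  clie a (clie b c) + clie b (clie c a) + clie c (clie a b) = 0.
Proof. by apply: cfree_lieP => n /=; rewrite lie_jacobi. Qed.

HB.instance Definition _ := Lmodule_isLie.Build K cfree_lie
  clieDl clieDr clieZl clieZr cliexx clie_jacobi.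

(* Convergence of series in the inverse limit topology, every quotient
   free_lie / filt n being discrete. *)
Definition sums_to (s : nat -> cfree_lie) (l : cfree_lie) : Prop :=
  forall n, exists m, forall p, (m <= p)%N ->
    (\sum_(k < p) s k : cfree_lie) n = l n.

Definition csum (s : nat -> cfree_lie) : cfree_lie :=
  xget 0 [set l | sums_to s l]%classic.

Definition ad (a : cfree_lie) : cfree_lie -> cfree_lie := lie a.

Definition exp_ad (a b : cfree_lie) : cfree_lie :=
  csum (fun k => (k`!%:R : K)^-1 *: iter k (ad a) b).

Lemma sums_to_uniq s l l' : sums_to s l -> sums_to s l' -> l = l'.
Proof.
move=> sl sl'; apply: cfree_lieP => n.
have [m Hm] := sl n; have [m' Hm'] := sl' n.
by rewrite -(Hm (maxn m m')) ?leq_maxl// -(Hm' (maxn m m')) ?leq_maxr.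
Qed.

Lemma sums_to_ex (s : nat -> cfree_lie) :
  (forall n k, (n <= k)%N -> s k n = 0) -> exists l, sums_to s l.
Proof.
move=> s0; pose S p : cfree_lie := \sum_(k < p) s k.
have SE n p : (n <= p)%N -> S p n = S n n.
  elim: p => [|p IH]; first by rewrite leqn0 => /eqP->.
  rewrite leq_eqVlt => /orP[/eqP->//|np].
  by rewrite /S big_ord_recr /= -/(S p) s0// addr0 IH.
have lP n : trans (S n.+1 n.+1) = S n n.
  by rewrite cprojP; apply: SE.
by exists (CFreeLie lP) => n; exists n => p np /=; apply: SE.
Qed.

Lemma iter_ad_eq0 a b n k : (n <= k)%N -> iter k (ad a) b n = 0.
Proof.
move=> nk; suff [c Fc ->] : exists2 c, filt k c & iter k (ad a) b n = pi_trunc n c.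
  by apply/pi_truncP; rewrite subr0; apply: filt_le Fc.
elim: k {nk} => [|k [c Fc /= E]].
  by exists (repr (b n)); [apply: filt_le (filt1 _)|rewrite repr_truncK].
exists (lie (repr (a n)) c); first exact: (filt_lie (filt1 _) Fc).
have [_ _ ->] := pi_trunc_morphism n.
by rewrite repr_truncK -E.
Qed.

Lemma exp_adP a b :
  sums_to (fun k => (k`!%:R : K)^-1 *: iter k (ad a) b) (exp_ad a b).
Proof.
apply: xgetPex; apply: sums_to_ex => n k nk /=.
rewrite -[LHS]/((k`!%:R : K)^-1 *: iter k (ad a) b n).
by rewrite iter_ad_eq0// scaler0.
Qed.

End FreeLieAlgebra.

Section TwoGenerators.
Variable K : fieldType.

(* A vector space concentrated in degree 1 has an s-Lie bracket exactly when
   it has an ordinary Lie bracket, since a graded symmetric bracket of degree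
   -1 on it preserves the degree and is antisymmetric. *)
Definition hsLie : lieAlgType K := cfree_lie K bool.
Definition gen_x : hsLie := chat (fgen K true).
Definition gen_y : hsLie := chat (fgen K false).

End TwoGenerators.

(* Main.v *)
(* Existence. Let Y be the degree derivation of the free Lie algebra L and put
   D = Y - ad x. For any derivation D one has
     D e^(ad z) = e^(ad z) (D + ad (psi_z (D z))),
   where psi_z = (1 - e^(- ad z)) / ad z.
   Applied to x, where D x = x, and to y, where Y y = y, this shows that
   G = e^(ad x) e^(ad y) satisfies D G = G (Y + ad y). In characteristic 0 the
   equation psi_z (D z) = x + y has a solution z in the completion, found degree
   by degree, and e^(ad z) then satisfies the same equation as G. That equation
   determines an operator congruent to the identity, again degree by degree.

   Uniqueness. If e^(ad a) = e^(ad b) and a = b up to degree n, the leading term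
   of a - b is central. It vanishes: its image in the noncommutative power
   series commutes with both letters, hence is 0, and by Dynkin-Specht-Wever
   n c is recovered from the image of a homogeneous c of degree n. *)

Require Import Defs.
From HB Require Import structures.
From mathcomp Require Import all_boot all_algebra.
From mathcomp Require Import boolp functions.
From mathcomp Require Import zify ring.

Set Implicit Arguments.
Unset Strict Implicit.
Unset Printing Implicit Defensive.

Import GRing.Theory.
Local Open Scope ring_scope.

(** * Lie identities and truncated power series in [ad] *)

Section LieBracket.
Variables (K : fieldType) (L : lieAlgType K).
Implicit Types a b c : L.

Fact lie_is_linear a : linear (lie a).
Proof. by move=> k b c; rewrite lieDr lieZr. Qed.
HB.instance Definition _ a := GRing.isLinear.Build K L L *:%R (lie a)
  (lie_is_linear a).

Lemma lieNl a b : lie (- a) b = - lie a b.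
Proof. by rewrite -scaleN1r lieZl scaleN1r. Qed.

Lemma lieBl a b c : lie (a - b) c = lie a c - lie b c.
Proof. by rewrite lieDl lieNl. Qed.

Lemma lieC a b : lie a b = - lie b a.
Proof.
apply/eqP; rewrite -addr_eq0; apply/eqP.
by have := liexx (a + b); rewrite lieDl !lieDr !liexx add0r addr0.
Qed.

Lemma lie_lie a b c : lie a (lie b c) = lie (lie a b) c + lie b (lie a c).
Proof.
have /eqP := lie_jacobi a b c; rewrite -addrA addr_eq0 => /eqP->.
by rewrite (lieC c a) linearN /= (lieC c) opprD !opprK addrC.
Qed.

Lemma iter_lieD a k b c :
  iter k (lie a) (b + c) = iter k (lie a) b + iter k (lie a) c.
Proof. by elim: k => //= k ->; rewrite linearD. Qed.

Lemma iter_lieZ a k t b : iter k (lie a) (t *: b) = t *: iter k (lie a) b.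
Proof. by elim: k => //= k ->; rewrite linearZ. Qed.

(** Series are cut after [N] terms so that computations take place before completion; in the free
    Lie algebra the tail lies in [filt N]. *)
Definition adseries (f : nat -> K) N a b : L :=
  \sum_(k < N) f k *: iter k (lie a) b.

Fact adseries_is_linear f N a : linear (adseries f N a).
Proof.
move=> t b c; rewrite /adseries scaler_sumr -big_split; apply: eq_bigr => k _.
by rewrite /= iter_lieD iter_lieZ scalerDr !scalerA mulrC.
Qed.
HB.instance Definition _ f N a := GRing.isLinear.Build K L L *:%R
  (adseries f N a) (adseries_is_linear f N a).

Definition derivation (D : L -> L) :=
  forall a b, D (lie a b) = lie (D a) b + lie a (D b).

(** Induction on n, peeling off the innermost [lie z]. With [U j] the j-th iterate of [lie z] on
    [D z], Jacobi moves [lie (U j)] past [lie z] at the cost of [- lie (U j.+1)], and Pascal's rule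
    collects the coefficients. *)
Lemma derivation_iter (D : {linear L -> L}) : derivation D -> forall n z b,
  D (iter n (lie z) b) = iter n (lie z) (D b)
   + \sum_(0 <= j < n) ((-1) ^+ j *+ 'C(n, j.+1)) *:
        iter (n - j.+1) (lie z) (lie (iter j (lie z) (D z)) b).
Proof.
move=> DL n z; elim: n => [|n IHn] b; first by rewrite big_geq// addr0.
rewrite iterSr IHn DL iter_lieD -iterSr [X in X + _]addrC -addrA; congr (_ + _).
set U := fun j => iter j (lie z) (D z).
set W := fun i j => iter i (lie z) (lie (U j) b).
have UE j : lie (U j) (lie z b) = lie z (lie (U j) b) - lie (U j.+1) b.
  by rewrite (lie_lie z) /= addrC addKr.
under eq_big_nat => j /andP[_ jn].
  rewrite -/(U j) UE iter_lieD -scaleN1r iter_lieZ -iterSr.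
  rewrite -subSn// subSS -/(W _ _) -/(W _ _) scaleN1r.
  over.
rewrite -/(U 0%N) -/(W n 0%N).
under [RHS]eq_big_nat => j /andP[_ jn].
  rewrite -/(U j) -/(W _ _) subSS binS mulrnDr scalerDl; over.
rewrite [RHS]big_split /= big_nat_recr//= bin_small// mulr0n scale0r addr0.
rewrite [in RHS]big_nat_recl//= bin0 subn0 expr0 scale1r.
rewrite [RHS]addrCA; congr (_ + _).
rewrite -big_split /=; apply: eq_bigr => j _.
by rewrite scalerBr exprS mulN1r mulNrn scaleNr.
Qed.

End LieBracket.

Notation adexp := (adseries (fun k => k`!%:R^-1)).

(* Truncation of the series (1 - exp (- ad a)) / ad a. *)
Notation adpsi := (adseries (fun k => (-1) ^+ k / k.+1`!%:R)).

Lemma adpsi_id (K : fieldType) (L : lieAlgType K) N (a : L) :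
  adpsi N.+1 a a = a.
Proof.
rewrite /adseries big_ord_recl /= expr0 divr1 scale1r big1 ?addr0// => i _.
rewrite -iterS iterSr liexx.
suff -> : iter i (lie a) 0 = 0 by rewrite scaler0.
by elim: (nat_of_ord i) => //= m ->; rewrite lier0.
Qed.

Lemma sum_triangle (V : nmodType) (g : nat -> nat -> V) N :
  \sum_(n < N) \sum_(0 <= j < n) g (n - j.+1)%N j =
  \sum_(0 <= j < N) \sum_(0 <= i < N - j.+1) g i j.
Proof.
elim: N => [|N IHN]; first by rewrite big_ord0 big_geq.
rewrite big_ord_recr IHN /= [RHS]big_nat_recr//= subnn.
rewrite [X in _ = _ + X]big_geq// addr0 -big_split /=.
apply: eq_big_nat => j /andP[_ jN].
by rewrite subSS -(subnSK jN) big_nat_recr.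
Qed.

(** * Truncated exponentials modulo the bracket-length filtration *)

Section Filtration.
Variables (K : fieldType) (X : Type).
Hypothesis char0 : [pchar K] =i pred0.
Local Notation L := (free_lie K X).
Implicit Types a b c z : L.

Lemma natK_neq0 n : (0 < n)%N -> n%:R != 0 :> K.
Proof. by case: n => // n _; rewrite (pcharf0P _).1. Qed.

Lemma filt_sum N (I : Type) (r : seq I) (P : pred I) (F : I -> L) :
  (forall i, P i -> filt N (F i)) -> filt N (\sum_(i <- r | P i) F i).
Proof. by move=> F0; elim/big_ind: _ => //; [exact: filt0|exact: filtD]. Qed.

Lemma filt_sub N a b c : filt N (a - b) -> filt N (b - c) -> filt N (a - c).
Proof. by move=> ab bc; rewrite -(subrKA b); apply: filtD. Qed.

Lemma filt_iter n k a b : filt n b -> filt (k + n) (iter k (lie a) b).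
Proof.
by move=> Fb; elim: k => //= k IH; apply: (filt_lie (filt1 a) IH).
Qed.

(** Telescoping: each replacement of one [a] by [b] produces a factor [a - b] in [filt n], while the
    other k - 1 factors and [c] each have length at least 1. *)
Lemma filt_iterB n k a b c : filt n (a - b) ->
  filt (n + k) (iter k (lie a) c - iter k (lie b) c).
Proof.
move=> Fab; elim: k => [|k IH] /=; first by rewrite subrr; apply: filt0.
set u := iter k _ _ in IH *; set v := iter k _ _ in IH *.
have -> : lie a u - lie b v = lie (a - b) u + lie b (u - v).
  by rewrite lieBl linearB /= addrA subrK.
apply: filtD; last by rewrite addnS -add1n; apply/filt_lie/IH/filt1.
apply: filt_lie => //; rewrite -addn1; exact/filt_iter/filt1.
Qed.

(* The two sides differ by those products of terms of the two truncated series
   that are brackets of length greater than N. *)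
Lemma derivation_adexp (D : {linear L -> L}) : derivation D -> forall N z b,
  filt N (D (adexp N z b) - adexp N z (D b + lie (adpsi N z (D z)) b)).
Proof.
move=> DL N z b; rewrite [adexp N z (_ + _)]linearD opprD addrA /=.
pose g i j : L := ((i`!%:R)^-1 * ((-1) ^+ j / j.+1`!%:R)) *:
  iter i (lie z) (lie (iter j (lie z) (D z)) b).
have -> : D (adexp N z b) - adexp N z (D b) =
          \sum_(0 <= j < N) \sum_(0 <= i < N - j.+1) g i j.
  rewrite -sum_triangle /adseries linear_sum -sumrB /=; apply: eq_bigr => n _.
  rewrite linearZ -scalerBr /= (derivation_iter DL) addrC addKr scaler_sumr.
  apply: eq_big_nat => j /andP[_ jn]; rewrite scalerA; congr (_ *: _).
  have n0 : n`!%:R != 0 :> K by rewrite natK_neq0// fact_gt0.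
  have i0 : (n - j.+1)`!%:R != 0 :> K by rewrite natK_neq0// fact_gt0.
  have j0 : (j.+1)`!%:R != 0 :> K by rewrite natK_neq0// fact_gt0.
  apply: (mulfI n0); rewrite mulVKf// -mulr_natr.
  (* The claim reduces to C(n, j+1) / n! = 1 / ((n-j-1)! (j+1)!). *)
  rewrite -(bin_fact jn) natrM (natrM _ j.+1`!).
  move: ((j.+1)`!%:R) ((n - j.+1)`!%:R) i0 j0 => u v v0 u0.
  by field; rewrite u0 v0.
have -> : adexp N z (lie (adpsi N z (D z)) b) =
          \sum_(0 <= j < N) \sum_(0 <= i < N) g i j.
  have -> : lie (adpsi N z (D z)) b = \sum_(0 <= j < N)
      ((-1) ^+ j / j.+1`!%:R) *: lie (iter j (lie z) (D z)) b.
    rewrite lieC /adseries linear_sum -sumrN big_mkord /=.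
    by apply: eq_bigr => j _; rewrite linearZ -scalerN /= -lieC.
  rewrite linear_sum /=; apply: eq_bigr => j _.
  rewrite big_mkord; apply: eq_bigr => i _.
  by rewrite /g iter_lieZ scalerA.
(* The square minus the triangle leaves i + j + 1 >= N, hence brackets of length at least i + j + 2
   > N. *)
rewrite -sumrB big_nat_cond; apply: filt_sum => j /andP[/andP[_ jN] _].
rewrite [X in _ - X](big_cat_nat (leq0n (N - j.+1)%N) (leq_subr _ _)) /=.
rewrite opprD addrA subrr sub0r -scaleN1r big_nat_cond.
apply/filtZ/filt_sum => i /andP[/andP[Ni _] _]; apply: filtZ.
apply: (@filt_le _ _ _ (i + (j + 1 + 1))); first by lia.
by apply/filt_iter/filt_lie/filt1/filt_iter/filt1.
Qed.

Lemma filt_adseriesB f N n a b c : filt n (a - b) ->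
  filt n.+1 (adseries f N a c - adseries f N b c).
Proof.
move=> Fab; rewrite /adseries -sumrB; apply: filt_sum => -[[|k] kN] _ /=.
  by rewrite subrr; apply: filt0.
rewrite -scalerBr; apply: filtZ; apply: (@filt_le _ _ _ (n + k.+1)); first lia.
exact: (filt_iterB k.+1).
Qed.

Lemma filt_adseries_lead f N n a b : filt n b ->
  filt n.+1 (adseries f N.+1 a b - f 0%N *: b).
Proof.
move=> Fb; rewrite /adseries big_ord_recl /= addrC addKr.
apply: filt_sum => i _; apply/filtZ/(@filt_le _ _ _ (i.+1 + n)); first lia.
exact: (filt_iter i.+1).
Qed.


Lemma filt_adexp_lead N n a b : filt n b -> filt n.+1 (adexp N.+1 a b - b).
Proof.
move=> /(filt_adseries_lead (fun k => k`!%:R^-1) N a).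
by rewrite invr1 scale1r.
Qed.

Lemma filt_adpsi_lead N n a b : filt n b -> filt n.+1 (adpsi N.+1 a b - b).
Proof.
move=> /(filt_adseries_lead (fun k => (-1) ^+ k / k.+1`!%:R) N a).
by rewrite expr0 divr1 scale1r.
Qed.

End Filtration.

(** * Dual numbers and the degree derivation *)

(* The Lie algebra L[e]/(e^2); a Lie morphism L -> L[e]/(e^2) lifting the
   identity is the same thing as a derivation of L. *)
Definition dual_lie (K : fieldType) (L : lieAlgType K) : Type := (L * L)%type.

Section DualNumbers.
Variables (K : fieldType) (L : lieAlgType K).

HB.instance Definition _ := GRing.Lmodule.copy (dual_lie L) (L * L)%type.

Definition dlie (u v : dual_lie L) : dual_lie L :=
  (lie u.1 v.1, lie u.1 v.2 + lie u.2 v.1).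

Fact dlieDl u v w : dlie (u + v) w = dlie u w + dlie v w.
Proof. by congr (_, _); rewrite /= !lieDl// addrACA. Qed.

Fact dlieDr u v w : dlie u (v + w) = dlie u v + dlie u w.
Proof. by congr (_, _); rewrite /= !lieDr// addrACA. Qed.

Fact dlieZl k u v : dlie (k *: u) v = k *: dlie u v.
Proof. by congr (_, _); rewrite /= !lieZl// scalerDr. Qed.

Fact dlieZr k u v : dlie u (k *: v) = k *: dlie u v.
Proof. by congr (_, _); rewrite /= !lieZr// scalerDr. Qed.

Fact dliexx u : dlie u u = 0.
Proof. by congr (_, _); rewrite /= ?liexx// (lieC u.2) subrr. Qed.

Fact dlie_jacobi u v w :
  dlie u (dlie v w) + dlie v (dlie w u) + dlie w (dlie u v) = 0.
Proof.
congr (_, _) => /=; first exact: lie_jacobi.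
(* The nine terms form three Jacobi identities, according to which argument contributes its second
   component. *)
rewrite !lieDr [LHS](AC (3*3*3) ((1*5*9)*(2*6*7)*(3*4*8))).
by rewrite /= !lie_jacobi !addr0.
Qed.

HB.instance Definition _ := Lmodule_isLie.Build K (dual_lie L)
  dlieDl dlieDr dlieZl dlieZr dliexx dlie_jacobi.

End DualNumbers.

Section DegreeDerivation.
Variables (K : fieldType) (X : Type).
Local Notation L := (free_lie K X).

Lemma degree_derivation_exists : exists Y : {linear L -> L},
  derivation Y /\ forall x, Y (fgen K x) = fgen K x.
Proof.
have [f [[[fD fZ fL] fg] _]] := free_lie_universal
  (fun x => (fgen K x, fgen K x) : dual_lie L).
(* Since the first component is the identity, multiplicativity of [f] is the Leibniz rule for its
   second component. *)
have f1 a : (f a).1 = a.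
  elim/free_lie_ind: a => [x||a b IHa IHb|k a IHa|a b IHa IHb].
  - by rewrite fg.
  - by rewrite -(scale0r 0) fZ /= !scale0r.
  - by rewrite fD /= IHa IHb.
  - by rewrite fZ /= IHa.
  - by rewrite fL /= IHa IHb.
pose Y a := (f a).2.
have Ylin : linear Y by move=> k a b; rewrite /Y fD fZ.
pose YL : {linear L -> L} := HB.pack Y (GRing.isLinear.Build K L L _ Y Ylin).
exists YL; split=> [a b|x] /=; rewrite /Y; last by rewrite fg.
by rewrite fL /= !f1 addrC.
Qed.

Variable Y : {linear L -> L}.
Hypotheses (YL : derivation Y) (Ygen : forall x, Y (fgen K x) = fgen K x).

Lemma degree_bracket n a : is_bracket n a -> Y a = n%:R *: a.
Proof.
elim=> {n a} [x|p q a b _ IHa _ IHb]; first by rewrite Ygen scale1r.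
by rewrite YL IHa IHb lieZl lieZr -scalerDl natrD.
Qed.

Lemma filt_degree n a : filt n a -> filt n.+1 (Y a - n%:R *: a).
Proof.
elim=> {a} [m a nm Ba||a b _ IHa _ IHb|k a _ IHa].
- rewrite (degree_bracket Ba) -scalerBl.
  have [->|nm'] := eqVneq n m; first by rewrite subrr scale0r; apply: filt0.
  by apply/filtZ/filt_bracket/Ba; rewrite ltn_neqAle nm'.
- by rewrite linear0 scaler0 subrr; apply: filt0.
- by rewrite linearD scalerDr opprD addrACA; apply: filtD.
- by rewrite linearZ /= scalerA mulrC -scalerA -scalerBr; apply: filtZ.
Qed.

Hypothesis char0 : [pchar K] =i pred0.

(* Comparing the components of degree m + k shows that T raises the filtration
   by k + 1 as soon as it raises it by k > 0. *)
Lemma filt_intertwiner (T : {linear L -> L}) (u v : L) N :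
  (forall n b, filt n b -> filt n.+1 (T b)) ->
  (forall b, filt N (Y (T b) - lie u (T b) - T (Y b + lie v b))) ->
  forall b, filt N (T b).
Proof.
(* The gain is capped by [N] because [TE] holds only modulo [filt N]. *)
move=> T1 TE; suff TN k m b : filt m b -> filt (minn (m + k.+1) N) (T b).
  by move=> b; apply: filt_le (TN N 0%N b (filt_le (leq0n 1) (filt1 b))); lia.
elim: k m b => [|k IHk] m b Fb.
  by rewrite addn1; apply/(filt_le _ (T1 _ _ Fb))/geq_minl.
have [Nmk|mkN] := leqP N (m + k.+1).
  by apply: filt_le (IHk _ _ Fb); lia.
have FTb : filt (m + k.+1) (T b) by apply: filt_le (IHk _ _ Fb); lia.
have -> : minn (m + k.+2) N = (m + k.+1).+1 by lia.
(* k + 1 is the difference between the eigenvalue m + k + 1 of [Y] on the leading part of [T b] and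
   m on that of [b]. *)
have -> : T b = k.+1%:R^-1 *: (k.+1%:R *: T b).
  by rewrite scalerA mulVf ?scale1r// natK_neq0.
apply: filtZ.
have H1 := filt_degree FTb.
have H2 : filt (m + k.+1).+1 (T (Y b - m%:R *: b)).
  by apply: filt_le (IHk _ _ (filt_degree Fb)); lia.
have H3 : filt (m + k.+1).+1 (T (lie v b)).
  by apply: filt_le (IHk _ _ (filt_lie (filt1 v) Fb)); lia.
have H4 : filt (m + k.+1).+1 (lie u (T b)) by apply: (filt_lie (filt1 u) FTb).
have H5 : filt (m + k.+1).+1 (Y (T b) - lie u (T b) - T (Y b + lie v b)).
  by apply: filt_le (TE b).
have -> : k.+1%:R *: T b = (Y (T b) - lie u (T b) - T (Y b + lie v b))
   - (Y (T b) - (m + k.+1)%:R *: T b) + T (Y b - m%:R *: b) + T (lie v b)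
   + lie u (T b).
  rewrite natrD scalerDl [T (_ - _)]linearB [T (_ + _)]linearD.
  rewrite [T (_ *: _)]linearZ /=.
  rewrite opprB opprD [RHS](AC (2*2*3*2*1*1)
    ((1*7)*(11*2)*(8*3)*(10*4)*(5*9)*6)).
  by rewrite /= !subrr !add0r.
by apply/filtD/H4/filtD/H3/filtD/H2/filtB.
Qed.

End DegreeDerivation.

(** * Existence: solving the differential equation *)

Section BCHExistence.
Variables (K : fieldType) (X : Type).
Hypothesis char0 : [pchar K] =i pred0.
Local Notation L := (free_lie K X).

Lemma filt_adseries f N n (a b : L) : filt n b -> filt n (adseries f N a b).
Proof.
move=> Fb; apply: filt_sum => i _; apply/filtZ/(@filt_le _ _ _ (i + n)).
  exact: leq_addl.
exact: filt_iter.
Qed.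

(* The equation psi_z (D z) = h is solved degree by degree, since its
   component of degree n.+1 reads n.+1 *: z_(n.+1) = (terms of lower degree). *)
Lemma adpsi_ode (D : {linear L -> L}) (h : L) :
  (forall n a, filt n a -> filt n.+1 (D a - n%:R *: a)) ->
  exists z : nat -> L, forall n,
    filt n (z n.+1 - z n) /\ filt n (adpsi n (z n) (D (z n)) - h).
Proof.
move=> FD; pose r n z := h - adpsi n.+1 z (D z).
(* The residue [r n (z n)] will lie in [filt n.+1], where [D] acts on leading parts as n + 1;
   dividing by n + 1 gives the correction that cancels it. *)
pose fix z n : L := if n is n'.+1 then z n' + n%:R^-1 *: r n' (z n') else 0.
have rF n : filt n.+1 (adpsi n (z n) (D (z n)) - h) -> filt n.+1 (r n (z n)).
  move=> F; rewrite /r {1}/adseries big_ord_recr /= -/(adpsi _ _ _) opprD addrA.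
  apply: filtB; first by rewrite -opprB -scaleN1r; apply: filtZ.
  by apply: filtZ; rewrite -addn1; apply/filt_iter/filt1.
have zF n : filt n.+1 (adpsi n (z n) (D (z n)) - h).
  elim: n => [|n IHn]; first exact: filt1.
  have Fr := rF n IHn; rewrite [z n.+1]/=.
  set r0 := r n (z n) in Fr *; set c := _ *: r0.
  have Fc : filt n.+1 c by apply: filtZ.
  have rE : r0 = n.+1%:R *: c by rewrite scalerA divff ?scale1r// natK_neq0.
  have Fz : filt n.+1 (z n + c - z n) by rewrite addrC addKr.
  set u := D (z n + c).
  have H1 := filt_adseriesB (fun k => (-1) ^+ k / k.+1`!%:R) n.+1 u Fz.
  have FDc : filt n.+1 (D c).
    rewrite -[D c](subrK (n.+1%:R *: c)).
    by apply: filtD; [apply/(filt_le _ (FD _ _ Fc))|apply: filtZ].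
  have H2 := filt_adpsi_lead n (z n) FDc.
  (* Three errors, each in [filt n.+2]: moving the base point, replacing [adpsi] of [D c] by its
     leading term, and replacing [D c] by (n + 1) c. *)
  have -> : adpsi n.+1 (z n + c) u - h
    = (adpsi n.+1 (z n + c) u - adpsi n.+1 (z n) u)
      + (adpsi n.+1 (z n) (D c) - D c) + (D c - n.+1%:R *: c).
    rewrite -rE /r0 /r /u [D (z n + c)]linearD.
    rewrite [adpsi _ (z n) (_ + _)]linearD /=.
    rewrite opprD opprB [RHS](AC (1*2*2*(1*2)) ((1*8)*(7*2)*(4*3)*(6*5))).
    by rewrite /= !subrr !addr0.
  by apply/filtD/FD/Fc/filtD/H2.
exists z => n; split; last exact: filt_le (zF n).
by rewrite /= addrC addKr; apply/filtZ/(filt_le _ (rF n (zF n))).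
Qed.

Lemma adexp_bch (x y : X) : exists z : nat -> L, forall n,
  filt n (z n.+1 - z n) /\
  forall b, filt n (adexp n (z n) b
                    - adexp n (fgen K x) (adexp n (fgen K y) b)).
Proof.
have [Y [YL Ygen]] := degree_derivation_exists K X.
set gx := fgen K x; set gy := fgen K y.
pose D : {linear L -> L} := Y \- lie gx.
have DL : derivation D.
  move=> a b; rewrite /= YL lie_lie lieBl linearB /=.
  by rewrite opprD addrACA.
have FD n a : filt n a -> filt n.+1 (D a - n%:R *: a).
  move=> Fa; rewrite /= addrAC; apply: filtB; first exact: filt_degree.
  exact: (filt_lie (filt1 gx) Fa).
have [z zP] := adpsi_ode (gx + gy) FD; exists z => n; split.
  by case: (zP n).
(* For n = 0 the truncated exponentials lack even the identity term, but [filt 0] is everything. *)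
case: n => [|n] b; first exact: filt_le (filt1 _).
have [_ zE] := zP n.+1; set N := n.+1 in zE *.
pose T : {linear L -> L} :=
  adexp N (z N) \- (adexp N gx \o adexp N gy).
apply: (filt_intertwiner YL Ygen char0 (T := T) (u := gx) (v := gy)).
  (* Both operators are the identity on leading parts, so [T] raises the filtration. *)
  move=> m {}b Fb.
  have Eb := filt_adexp_lead n gy Fb.
  have FEb : filt m (adexp N gy b) by apply: filt_adseries.
  have -> : T b = (adexp N (z N) b - b) - (adexp N gy b - b)
      - (adexp N gx (adexp N gy b) - adexp N gy b).
    by rewrite opprB addrA subrK opprB addrA subrK.
  apply: filtB; last exact: filt_adexp_lead.
  by apply: filtB => //; apply: filt_adexp_lead.
move=> {}b; set b' := Y b + lie gy b.
have -> : Y (T b) - lie gx (T b) - T b' =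
    (D (adexp N (z N) b) - adexp N (z N) b')
  - (D (adexp N gx (adexp N gy b)) - adexp N gx (adexp N gy b')).
  rewrite -[Y (T b) - _]/(D (T b)) /T [D (_ - _)]linearB /=.
  by rewrite !opprB [LHS](AC (2*2) ((1*4)*(3*2))).
apply: filtB.
  apply: (filt_sub (derivation_adexp char0 DL N (z N) b)).
  rewrite -[adexp N _ _ - _]linearB; apply: filt_adseries.
  have -> : D b + lie (adpsi N (z N) (D (z N))) b - b'
     = lie (adpsi N (z N) (D (z N)) - (gx + gy)) b.
    rewrite lieBl lieDl /b' /= !opprD [LHS](AC (2*1*2) (3*2*5*(1*4))) /=.
    by rewrite subrr addr0 addrA.
  exact: filt_liel.
apply: (filt_sub (derivation_adexp char0 DL N gx _)).
rewrite -[adexp N _ _ - _]linearB; apply: filt_adseries.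
(* Hence moving [D] across exp(ad x) turns it into D + ad x = [Y], and moving [Y] across exp(ad y)
   gives Y + ad y. *)
have -> : D gx = gx by rewrite /= Ygen liexx subr0.
rewrite adpsi_id /= subrK.
by have := derivation_adexp char0 YL N gy b; rewrite Ygen adpsi_id.
Qed.

End BCHExistence.

(** Passage between the completion and truncated series: terms of index at least n have length
    greater than n and vanish at level n. *)
Lemma exp_ad_pi (K : fieldType) (X : Type) (a b : cfree_lie K X) n a' b' :
  a n = pi_trunc n a' -> b n = pi_trunc n b' ->
  exp_ad a b n = pi_trunc n (adexp n a' b').
Proof.
move=> aE bE; have [m Hm] := exp_adP a b n.
have [pD pZ pL] := pi_trunc_morphism K X n.
have iterE k : iter k (ad a) b n = pi_trunc n (iter k (lie a') b').
  by elim: k => //= k IH; rewrite pL -aE -IH.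
have sumE p :
    (\sum_(k < p) (k`!%:R^-1 : K) *: iter k (ad a) b : cfree_lie K X) n =
    pi_trunc n (adexp p a' b').
  elim: p => [|p IHp]; first by rewrite /adseries !big_ord0.
  rewrite /adseries !big_ord_recr /= -/(adseries _ _ _) pD -IHp pZ -iterE.
  by [].
rewrite -(Hm (maxn m n)) ?leq_maxl// sumE; apply/pi_truncP.
rewrite -(subnKC (leq_maxr m n)); elim: (maxn m n - n)%N => [|p IHp].
  by rewrite addn0 subrr; apply: filt0.
rewrite addnS {1}/adseries big_ord_recr /= -/(adseries _ _ _) addrAC.
apply: filtD => //; apply: filtZ.
by apply: filt_le (filt_iter (n + p) a' (filt1 b')); lia.
Qed.

(** * The Lie algebra of noncommutative power series *)

(* Noncommutative power series in letters X, given by their coefficients. *)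
Definition series (K : fieldType) (X : Type) : Type := seq X -> K^o.

Section Series.
Variables (K : fieldType) (X : Type).
Local Notation S := (series K X).
Implicit Types f g h : S.

HB.instance Definition _ := GRing.Lmodule.copy S (seq X -> K^o).

Definition shift (x : X) f : S := fun w => f (x :: w).

(* The Cauchy product, by recursion on the word:
   (f * g)_x = f_[::] g_x + f_x * g, where f_x = shift x f. *)
Fixpoint smul f g (w : seq X) : K :=
  if w is x :: w' then f [::] * g w + smul (shift x f) g w'
  else f [::] * g [::].

Lemma smulDl f g h w : smul (f + g) h w = smul f h w + smul g h w.
Proof. by elim: w f g => [|x w IHw] f g /=; rewrite ?IHw !mulrDl// addrACA. Qed.

Lemma smulDr f g h w : smul f (g + h) w = smul f g w + smul f h w.
Proof. by elim: w f => [|x w IHw] f /=; rewrite ?IHw !mulrDr// addrACA. Qed.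

Lemma smulZl k f g w : smul (k *: f) g w = k * smul f g w.
Proof. by elim: w f => [|x w IHw] f /=; rewrite ?IHw ?mulrDr mulrA. Qed.

Lemma smulZr k f g w : smul f (k *: g) w = k * smul f g w.
Proof. by elim: w f => [|x w IHw] f /=; rewrite ?IHw ?mulrDr mulrCA. Qed.

Lemma smulA f g h w : smul f (smul g h) w = smul (smul f g) h w.
Proof.
elim: w f g => [|x w IHw] f g /=; first by rewrite mulrA.
have -> : shift x (smul f g) = f [::] *: shift x g + smul (shift x f) g by [].
by rewrite smulDl smulZl -IHw mulrDr !mulrA addrA.
Qed.

Definition slie f g : S := (smul f g : S) - smul g f.

Fact slieDl f g h : slie (f + g) h = slie f h + slie g h.
Proof.
by apply/funext => w; rewrite /slie !fctE smulDl smulDr opprD addrACA.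
Qed.

Fact slieDr f g h : slie f (g + h) = slie f g + slie f h.
Proof.
by apply/funext => w; rewrite /slie !fctE smulDl smulDr opprD addrACA.
Qed.

Fact slieZl k f g : slie (k *: f) g = k *: slie f g.
Proof. by apply/funext => w; rewrite /slie !fctE smulZl smulZr -mulrBr. Qed.

Fact slieZr k f g : slie f (k *: g) = k *: slie f g.
Proof. by apply/funext => w; rewrite /slie !fctE smulZl smulZr -mulrBr. Qed.

Fact sliexx f : slie f f = 0.
Proof. exact: subrr. Qed.

Fact slie_jacobi f g h :
  slie f (slie g h) + slie g (slie h f) + slie h (slie f g) = 0.
Proof.
have smulBl u v t : smul (u - v) t = (smul u t : S) - smul v t.
  by apply/funext => w; rewrite -scaleN1r smulDl smulZl mulN1r.
have smulBr u v t : smul t (u - v) = (smul t u : S) - smul t v.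
  by apply/funext => w; rewrite -scaleN1r smulDr smulZr mulN1r.
apply/funext => w; rewrite /slie !smulBl !smulBr !fctE !smulA.
have E (a b c d k l : K) :
  a - b - (c - d) + (c - k - (l - b)) + (l - d - (a - k)) = 0 by ring.
exact: E.
Qed.

HB.instance Definition _ := Lmodule_isLie.Build K S
  slieDl slieDr slieZl slieZr sliexx slie_jacobi.

Lemma lie_seriesE f g w : (lie f g : S) w = smul f g w - smul g f w.
Proof. by []. Qed.

End Series.

(** * Homogeneous series and sums over words in two letters *)

Section Words.
Variables (K : fieldType).

Definition homog (X : Type) n (f : series K X) :=
  forall w, size w != n -> f w = 0.

(** Among all cuts of the word, only the one after p letters meets the support of [f]. *)
Lemma smul_cat (X : Type) p (f g : series K X) w1 w2 : homog p f ->
  size w1 = p -> smul f g (w1 ++ w2) = f w1 * g w2.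
Proof.
have smul0 h w : (forall u, h u = 0) -> smul h g w = 0.
  elim: w h => [|x w IHw] h h0 /=; rewrite h0 mul0r// add0r IHw// => u.
  exact: h0.
elim: w1 p f => [|x w1 IHw] p f Hf /= wp; subst p.
  by case: w2 => //= x w2; rewrite smul0 ?addr0// => u; apply: Hf.
by rewrite Hf// mul0r add0r (IHw (size w1))// => u uw; apply: Hf.
Qed.

Lemma smul_short (X : Type) p (f g : series K X) w : homog p f ->
  (size w < p)%N -> smul f g w = 0.
Proof.
elim: w p f => [|x w IHw] [|p] f Hf //= wp; rewrite Hf// mul0r// add0r.
by apply: IHw wp => u up; apply: Hf.
Qed.

Lemma smul_homog (X : Type) p q (f g : series K X) :
  homog p f -> homog q g -> homog (p + q)%N (smul f g).
Proof.
move=> Hf Hg w wpq; have [wp|pw] := ltnP (size w) p.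
  exact: smul_short Hf wp.
rewrite -(cat_take_drop p w) (smul_cat _ _ Hf) ?size_takel// Hg ?mulr0//.
by rewrite size_drop; lia.
Qed.

Fixpoint wsum (V : nmodType) n (F : seq bool -> V) : V :=
  if n is n'.+1
  then wsum n' (F \o cons true) + wsum n' (F \o cons false) else F [::].

Lemma eq_wsum (V : nmodType) n (F G : seq bool -> V) :
  (forall w, size w = n -> F w = G w) -> wsum n F = wsum n G.
Proof.
elim: n F G => [|n IHn] F G FG /=; first exact: FG.
by congr (_ + _); apply: IHn => w wn; apply: FG; rewrite /= wn.
Qed.

Lemma wsum_cat (V : nmodType) p q (F : seq bool -> V) :
  wsum (p + q)%N F = wsum p (fun w1 => wsum q (fun w2 => F (w1 ++ w2))).
Proof. by elim: p F => //= p IHp F; rewrite !IHp. Qed.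

Lemma wsumB (V : zmodType) n (F G : seq bool -> V) :
  wsum n (fun w => F w - G w) = wsum n F - wsum n G.
Proof.
elim: n F G => //= n IHn F G; rewrite opprD addrACA -!IHn.
by congr (_ + _); apply: eq_wsum.
Qed.

Definition wcomb (V : lmodType K) n (c : seq bool -> K) (F : seq bool -> V) :=
  wsum n (fun w => c w *: F w).

Lemma wcomb_linear (V W : lmodType K) (h : {linear V -> W}) n c F :
  wcomb n c (h \o F) = h (wcomb n c F).
Proof.
rewrite /wcomb; elim: n c F => [|n IHn] c F /=; first by rewrite linearZ.
by rewrite linearD -(IHn (c \o cons true)) -(IHn (c \o cons false)).
Qed.

Lemma wcombB (V : lmodType K) n (c d : seq bool -> K) (F : seq bool -> V) :
  wcomb n (fun w => c w - d w) F = wcomb n c F - wcomb n d F.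
Proof. by rewrite -wsumB; apply: eq_wsum => w _; rewrite -scalerBl. Qed.

Lemma wsum0 (V : nmodType) n (F : seq bool -> V) :
  (forall w, size w = n -> F w = 0) -> wsum n F = 0.
Proof.
elim: n F => [|n IHn] F F0 /=; first exact: F0.
by rewrite !IHn ?addr0// => w wn; apply: F0; rewrite /= wn.
Qed.

End Words.

(** * The Dynkin-Specht-Wever theorem *)

Section Dynkin.
Variable K : fieldType.
Local Notation L := (free_lie K bool).
Local Notation S := (series K bool).
Local Notation wcomb := (@wcomb K L).

Definition letter (x : bool) : S := fun w =>
  if w is [:: y] then (x == y)%:R else 0.

Fixpoint ad_word (w : seq bool) (v : L) : L :=
  if w is x :: w' then lie (fgen K x) (ad_word w' v) else v.

Fixpoint rnested (w : seq bool) : L :=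
  if w is x :: w' then
    (if w' is [::] then fgen K x else lie (fgen K x) (rnested w'))
  else 0.

Lemma ad_word_cat w1 w2 v : ad_word (w1 ++ w2) v = ad_word w1 (ad_word w2 v).
Proof. by elim: w1 => //= x w ->. Qed.

Lemma rnested_cat w1 w2 : (0 < size w2)%N ->
  rnested (w1 ++ w2) = ad_word w1 (rnested w2).
Proof.
move=> w20; elim: w1 => //= x w1 <-.
by case: w1 => //; case: w2 w20.
Qed.

Lemma ad_word_linear w : linear (ad_word w).
Proof.
move=> k a b; elim: w => //= x w ->; exact: linearP.
Qed.
HB.instance Definition _ w := GRing.isLinear.Build K L L *:%R (ad_word w)
  (ad_word_linear w).

Variable phi : L -> S.
Hypothesis phiM : is_lie_morphism phi.
Hypothesis phig : forall x, phi (fgen K x) = letter x.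

Lemma phi_homog n a : is_bracket n a -> homog n (phi a).
Proof.
have [_ _ phiL] := phiM.
elim=> {n a} [x|p q a b _ IHa _ IHb] w wn.
  by rewrite phig; case: w wn => [|y []].
rewrite phiL lie_seriesE (smul_homog IHa IHb)//.
by rewrite (smul_homog IHb IHa) ?subrr// addnC.
Qed.

Lemma phi_filt n a w : filt n a -> (size w < n)%N -> phi a w = 0.
Proof.
have [phiD phiZ _] := phiM => Fa wn.
elim: Fa => {a} [m a nm Ba||a b _ IHa _ IHb|k a _ IHa].
- by apply: (phi_homog Ba); lia.
- by rewrite -(scale0r 0) phiZ scale0r.
- by rewrite phiD fctE IHa IHb addr0.
- by rewrite phiZ fctE IHa scaler0.
Qed.

(** The common inductive step of the next two results, for [F] equal to [ad_word^~ v] and to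
    [rnested]: each word is split after p letters. *)
Lemma wcomb_smul (p q : nat) (f g : S) (F : seq bool -> L) (a u : L) :
  homog p f -> (forall v, wcomb p f (ad_word^~ v) = lie a v) ->
  (forall w1 w2, size w2 = q -> F (w1 ++ w2) = ad_word w1 (F w2)) ->
  wcomb q g F = u -> wcomb (p + q) (smul f g) F = lie a u.
Proof.
move=> Hf fa FE gu; rewrite /wcomb wsum_cat -fa -gu; apply: eq_wsum => w1 w1p.
rewrite -wcomb_linear -(wcomb_linear ( *:%R (f w1 : K))).
apply: eq_wsum => w2 w2q.
by rewrite (smul_cat _ _ Hf)// FE//= !scalerA mulrC.
Qed.

(** Words act through the adjoint action of their letters, and the commutator of ad a and ad b is ad
    [a, b]. *)
Lemma wcomb_ad_word n a v : is_bracket n a ->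
  wcomb n (phi a) (ad_word^~ v) = lie a v.
Proof.
have [_ _ phiL] := phiM => Ba.
elim: Ba v => {n a} [x|p q a b Ba IHa Bb IHb] v.
  rewrite phig /wcomb; case: x;
  by rewrite /= scale1r scale0r ?addr0 ?add0r.
rewrite phiL [LHS](wcombB (p + q)).
rewrite (wcomb_smul (phi_homog Ba) IHa _ (IHb v)); last first.
  by move=> *; rewrite ad_word_cat.
rewrite addnC (wcomb_smul (phi_homog Bb) IHb _ (IHa v)); last first.
  by move=> *; rewrite ad_word_cat.
by rewrite lie_lie addrK.
Qed.

Lemma is_bracket_gt0 n (a : L) : is_bracket n a -> (0 < n)%N.
Proof. by elim=> // p q *; rewrite addn_gt0; apply/orP; left. Qed.

(** For a bracket of a and b of lengths p and q, the commutator of their images is sent to [a, q b]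
    - [b, p a] = (p + q) [a, b]. *)
Lemma dynkin_specht_wever n a : is_bracket n a ->
  wcomb n (phi a) rnested = n%:R *: a.
Proof.
have [_ _ phiL] := phiM.
elim=> {n a} [x|p q a b Ba IHa Bb IHb].
  rewrite phig /wcomb; case: x;
  by rewrite /= !scale1r scale0r ?addr0 ?add0r.
rewrite phiL [LHS](wcombB (p + q)).
rewrite (wcomb_smul (phi_homog Ba) (fun v => wcomb_ad_word v Ba) _ IHb);
  last first.
  by move=> w1 w2 w2q; rewrite rnested_cat// w2q (is_bracket_gt0 Bb).
rewrite addnC (wcomb_smul (phi_homog Bb) (fun v => wcomb_ad_word v Bb) _ IHa);
  last first.
  by move=> w1 w2 w2p; rewrite rnested_cat// w2p (is_bracket_gt0 Ba).
by rewrite !lieZr (lieC b a) scalerN opprK -scalerDl natrD addrC.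
Qed.

(** Brackets longer than n contribute no word of length n and already lie in [filt n.+1]. *)
Lemma filt_dynkin_specht_wever n a : filt n a ->
  filt n.+1 (wcomb n (phi a) rnested - n%:R *: a).
Proof.
have [phiD phiZ _] := phiM.
elim=> {a} [m a nm Ba||a b _ IHa _ IHb|k a _ IHa].
- have [->|nm'] := eqVneq n m.
    by rewrite (dynkin_specht_wever Ba) subrr; apply: filt0.
  rewrite [X in X - _]wsum0 ?sub0r.
    rewrite -scaleN1r; apply/filtZ/filtZ/filt_bracket/Ba.
    by rewrite ltn_neqAle nm'.
  move=> w wn; have -> : phi a w = 0 by apply: (phi_homog Ba); rewrite wn.
  exact: scale0r.
- rewrite scaler0 subr0 [X in filt _ X]wsum0; first exact: filt0.
  move=> w _; have -> : phi 0 = 0 by rewrite -(scale0r 0) phiZ scale0r.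
  exact: scale0r.
- rewrite scalerDr opprD.
  have -> : wcomb n (phi (a + b)) rnested
      = wcomb n (phi a) rnested + wcomb n (phi b) rnested.
    apply/eqP; rewrite -subr_eq -wcombB; apply/eqP/eq_wsum => w _.
    by rewrite phiD addrK.
  by rewrite addrACA; apply: filtD.
- have -> : wcomb n (phi (k *: a)) rnested = k *: wcomb n (phi a) rnested.
    rewrite -(wcomb_linear ( *:%R k)); apply: eq_wsum => w _.
    by rewrite phiZ /= scalerA mulrC -scalerA.
  by rewrite scalerA mulrC -scalerA -scalerBr; apply: filtZ.
Qed.

End Dynkin.

(** * Triviality of the center and uniqueness *)

Section Center.
Variable K : fieldType.
Local Notation L := (free_lie K bool).
Local Notation S := (series K bool).

Lemma smul_letterl x (f : S) y w :
  smul (letter K x) f (y :: w) = (x == y)%:R * f w.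
Proof.
by rewrite -cat1s (@smul_cat _ _ 1) => // -[|? []].
Qed.

Lemma smul_letterr (f : S) x w y :
  smul f (letter K x) (rcons w y) = f w * (x == y)%:R.
Proof.
elim: w f => [|z w IHw] f /=; first by rewrite mulr0 addr0.
by rewrite IHw; case: w {IHw} => [|? ?] /=; rewrite mulr0 add0r.
Qed.

Hypothesis char0 : [pchar K] =i pred0.

(* If f is homogeneous and commutes with both letters, then the coefficient of
   a word ending in b vanishes, as seen on that word preceded by the letter
   other than b. *)
Lemma filt_center n (c : L) :
  (forall x, filt n.+2 (lie c (fgen K x))) -> filt n c -> filt n.+1 c.
Proof.
case: n => [|n] Fg Fc; first exact: filt1.
have [phi [[phiM phig] _]] := free_lie_universal (letter K).
have phi0 w : size w = n.+1 -> phi c w = 0.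
  case/lastP: w => // w b wn; pose x := ~~ b.
  have [_ _ phiL] := phiM.
  have : phi (lie c (fgen K x)) (x :: rcons w b) = 0.
    by apply: (phi_filt phiM phig (Fg x)); rewrite /= wn.
  rewrite phiL phig lie_seriesE smul_letterl -rcons_cons smul_letterr.
  have -> : (x == b) = false by rewrite /x; case: (b).
  rewrite mulr0 eqxx mul1r sub0r.
  by move/eqP; rewrite oppr_eq0 => /eqP.
(* With all coefficients in length n + 1 zero, this puts (n + 1) c in [filt n.+2]. *)
have := filt_dynkin_specht_wever phiM phig Fc.
rewrite [wcomb _ _ _]wsum0 ?sub0r => [F|w /phi0 ->]; last exact: scale0r.
rewrite -[c]scale1r -(mulVf (natK_neq0 char0 (ltn0Sn n))) -scalerA.
by apply: filtZ; rewrite -[_ *: _]opprK -scaleN1r; apply: filtZ.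
Qed.

(** In the difference of exponentials index 0 cancels, index 1 gives the bracket, and index k >= 2
    lies in [filt (n + k)]. *)
Lemma filt_adexpB n (a b u : L) : filt n (a - b) ->
  filt n.+2 (adexp n.+2 a u - adexp n.+2 b u) -> filt n.+2 (lie (a - b) u).
Proof.
move=> Fab; rewrite /adseries -sumrB 2!big_ord_recl /= subrr add0r.
rewrite invr1 !scale1r -lieBl => F.
rewrite -[lie _ _](addrK (\sum_(i < n)
  ((2 + i)`!%:R^-1 *: iter (2 + i) (lie a) u
   - (2 + i)`!%:R^-1 *: iter (2 + i) (lie b) u))).
apply: filtB => //; apply: filt_sum => i _; rewrite -scalerBr; apply: filtZ.
by apply: filt_le (filt_iterB (2 + i) u Fab); lia.
Qed.

Lemma exp_ad_inj (a b : cfree_lie K bool) : exp_ad a =1 exp_ad b -> a = b.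
Proof.
move=> ab; apply: cfree_lieP; elim=> [|n IHn].
  rewrite -(repr_truncK (a 0%N)) -(repr_truncK (b 0%N)).
  by apply/pi_truncP/(filt_le (leq0n 1))/filt1.
(* Level n + 2 is where the bracket of the degree n part of a - b with a generator, of degree n + 1,
   is seen to vanish. *)
pose a' := repr (a n.+2); pose b' := repr (b n.+2).
have aE : a n.+2 = pi_trunc n.+2 a' by rewrite repr_truncK.
have bE : b n.+2 = pi_trunc n.+2 b' by rewrite repr_truncK.
have aE1 : a n.+1 = pi_trunc n.+1 a' by rewrite -cprojP aE trans_pi.
have bE1 : b n.+1 = pi_trunc n.+1 b' by rewrite -cprojP bE trans_pi.
have Fab : filt n (a' - b').
  apply/pi_truncP; rewrite -!(trans_pi n) -aE1 -bE1 !cprojP; exact: IHn.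
rewrite aE1 bE1; apply/pi_truncP; apply: (filt_center _ Fab) => x.
apply: filt_adexpB => //; apply/pi_truncP.
have uE : chat (fgen K x) n.+2 = pi_trunc n.+2 (fgen K x) by [].
by rewrite -(exp_ad_pi aE uE) -(exp_ad_pi bE uE) ab.
Qed.

End Center.

Theorem proposition5p14 (K : fieldType) (char0 : [pchar K] =i pred0) :
  exists! BCH : hsLie K,
    exp_ad BCH =1 exp_ad (gen_x K) \o exp_ad (gen_y K).
Proof.
have [z zP] := adexp_bch char0 true false.
(* Successive approximations agree modulo [filt n], so they define a point of the inverse limit. *)
have zE n : trans (pi_trunc n.+1 (z n.+1)) = pi_trunc n (z n).
  by rewrite trans_pi; apply/pi_truncP; case: (zP n).
pose B : hsLie K := CFreeLie zE.
have BE : exp_ad B =1 exp_ad (gen_x K) \o exp_ad (gen_y K).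
  move=> b; apply: cfree_lieP => n /=.
  have bE : b n = pi_trunc n (repr (b n)) by rewrite repr_truncK.
  rewrite (exp_ad_pi (erefl : B n = pi_trunc n (z n)) bE).
  have gyE : gen_y K n = pi_trunc n (fgen K false) by [].
  have gxE : gen_x K n = pi_trunc n (fgen K true) by [].
  rewrite (exp_ad_pi gxE (exp_ad_pi gyE bE)).
  by apply/pi_truncP; case: (zP n).
by exists B; split=> // B' B'E; apply: exp_ad_inj => // b; rewrite BE B'E.
Qed.
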